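(* Let $\Delta$ be a pure simplicial complex on vertex set $[n]=\{1,\ldots,n\}$. Then $\Delta$ is connected in codimension one if and only if $G_{I_{\Delta^\vee}}$ is a connected graph.
   Context: Let $F_1,\ldots,F_m$ be the facets of $\Delta$ and $\bar F_i=[n]\setminus F_i$. The Stanley-Reisner ideal of the Alexander dual $\Delta^\vee$ is $I_{\Delta^\vee}=(x_{\bar F_i}: i=1,\ldots,m)\subset k[x_1,\ldots,x_n]$, where $x_F=\prod_{i\in F}x_i$ and $k$ is a field. $\Delta$ is pure if all its facets have the same dimension. Two facets $F,F'$ are connected in codimension one if $|F\cap F'|=|F|-1$. $\Delta$ is connected in codimension one (strongly connected) if for any two facets $F,G$ there is a sequence of facets $F=F_0,F_1,\ldots,F_q=G$ such that $F_i$ and $F_{i+1}$ are connected in codimension one for each $i=0,\ldots,q-1$. For a squarefree monomial ideal $I$ generated in one degree with minimal monomial generating set $G(I)$, $G_I$ is the simple graph on $G(I)$ in which distinct $u,v$ are adjacent iff there are variables $x,y$ with $xu=yv$. *)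

(* Defs.v *)
From HB Require Import structures.
From mathcomp Require Import all_boot all_order all_algebra.
From mathcomp Require Import mpoly.

Set Implicit Arguments.
Unset Strict Implicit.
Unset Printing Implicit Defensive.

Import GRing.Theory.
Local Open Scope ring_scope.

(* Elements of the vertex set [n] need not be faces, and the void complex is
   allowed, so that complexes are closed under Alexander duality. *)
Record simplicial_complex (n : nat) := SimplicialComplex {
  faces : {set {set 'I_n}};
  faces_closed : forall F F' : {set 'I_n},
    F \in faces -> F' \subset F -> F' \in faces }.

Definition facets (n : nat) (D : simplicial_complex n) : {set {set 'I_n}} :=
  [set F : {set 'I_n} | maxset [pred A : {set 'I_n} | A \in faces D] F].

(* dim F = #|F| - 1 *)
Definition pure (n : nat) (D : simplicial_complex n) : Prop :=
  forall F G : {set 'I_n}, F \in facets D -> G \in facets D -> #|F| = #|G|.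

(* The successor is on the left because subtraction on nat is truncated. *)
Definition codim1_adj (n : nat) : rel {set 'I_n} :=
  fun F F' => #|F :&: F'|.+1 == #|F|.

Definition connected_in_codim1 (n : nat) (D : simplicial_complex n) : Prop :=
  forall F G : {set 'I_n}, F \in facets D -> G \in facets D ->
  exists p : seq {set 'I_n},
    [/\ path (@codim1_adj n) F p, last F p = G & {subset p <= facets D}].

Lemma alexander_dual_closed (n : nat) (D : simplicial_complex n)
    (F F' : {set 'I_n}) :
  F \in [set ~: A | A in ~: faces D] -> F' \subset F ->
  F' \in [set ~: A | A in ~: faces D].
Proof.
case/imsetP=> A; rewrite inE => AD ->{F} sF'A.
apply/imsetP; exists (~: F'); last by rewrite setCK.
rewrite inE; apply: contra AD => /faces_closed; apply.
by rewrite -setCS setCK.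
Qed.

Definition alexander_dual (n : nat) (D : simplicial_complex n) :
    simplicial_complex n :=
  SimplicialComplex (@alexander_dual_closed n D).

Definition ideal_gen (R : comNzRingType) (S : R -> Prop) (p : R) : Prop :=
  exists s : seq (R * R),
    (forall c, c \in s -> S c.2) /\ p = \sum_(c <- s) c.1 * c.2.

Definition sqfree_mon (k : fieldType) (n : nat) (F : {set 'I_n}) :
    {mpoly k[n]} :=
  \prod_(i in F) 'X_i.

Definition stanley_reisner (k : fieldType) (n : nat)
    (D : simplicial_complex n) : {mpoly k[n]} -> Prop :=
  ideal_gen (fun p => exists2 F : {set 'I_n},
    F \notin faces D & p = sqfree_mon k F).

Lemma ideal_gen_sub (R : comNzRingType) (S T : R -> Prop) (p : R) :
  (forall q, S q -> exists a b, T b /\ q = a * b) ->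
  ideal_gen S p -> ideal_gen T p.
Proof.
move=> ST [s [sS ->]] {p}; elim: s sS => [|c s IHs] sS.
  by exists [::]; rewrite !big_nil.
have [|t [tT E]] := IHs; first by move=> d ds; apply: sS; rewrite inE ds orbT.
have [|a [b [Tb Ec]]] := ST c.2; first by apply: sS; rewrite inE eqxx.
exists ((c.1 * a, b) :: t); split; last by rewrite !big_cons E Ec mulrA.
by move=> d; rewrite inE => /orP[/eqP->|/tT].
Qed.

Lemma stanley_reisner_dualE (k : fieldType) (n : nat)
    (D : simplicial_complex n) (p : {mpoly k[n]}) :
  stanley_reisner (alexander_dual D) p <->
  ideal_gen (fun q => exists2 F : {set 'I_n},
    F \in facets D & q = sqfree_mon k (~: F)) p.
Proof.
have dualE (A : {set 'I_n}) : (A \notin faces (alexander_dual D)) = (~: A \in faces D).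
  rewrite -[A in LHS]setCK (mem_imset _ _ (inv_inj (@setCK _))) inE negbK.
  by [].
split; apply: ideal_gen_sub => q [F FD ->].
  rewrite dualE in FD.
  have [G maxG sFG] := @maxset_exists _ [pred A | A \in faces D] _ FD.
  have sGF : ~: G \subset F by rewrite -setCS setCK.
  exists (sqfree_mon k (F :\: ~: G)), (sqfree_mon k (~: G)); split.
    by exists G; rewrite ?inE.
  by rewrite /sqfree_mon (big_setID (~: G)) (setIidPr sGF) /= mulrC.
exists 1, (sqfree_mon k (~: F)); split; last by rewrite mul1r.
exists (~: F) => //; rewrite dualE setCK.
by move: FD; rewrite inE => /maxsetp.
Qed.

Definition mon_ideal (k : fieldType) (n : nat) (G : 'X_{1..n} -> Prop) :
    {mpoly k[n]} -> Prop :=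
  ideal_gen (fun p => exists2 m : 'X_{1..n}, G m & p = 'X_[k, m]).

Definition min_mon_gen_set (k : fieldType) (n : nat)
    (I : {mpoly k[n]} -> Prop) (G : 'X_{1..n} -> Prop) : Prop :=
  (forall p, mon_ideal G p <-> I p) /\
  (forall H : 'X_{1..n} -> Prop, (forall m, H m -> G m) ->
     (forall p : {mpoly k[n]}, mon_ideal H p <-> I p) -> forall m, G m -> H m).

(* A monomial ideal has exactly one minimal monomial generating set, so the
   existential below denotes membership in that set. *)
Definition min_gens (k : fieldType) (n : nat)
    (I : {mpoly k[n]} -> Prop) (m : 'X_{1..n}) : Prop :=
  exists2 G, min_mon_gen_set I G & G m.

Definition linear_adj (k : fieldType) (n : nat) : rel 'X_{1..n} :=
  fun u v => (u != v) &&
    [exists i : 'I_n, exists j : 'I_n,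
       'X_i * 'X_[u] == 'X_j * 'X_[v] :> {mpoly k[n]}].

(* The graph without vertices counts as connected. It arises only from the void
   complex, which is likewise connected in codimension one. *)
Definition connected_graph (T : eqType) (V : T -> Prop) (e : rel T) : Prop :=
  forall u v : T, V u -> V v ->
  exists p : seq T,
    [/\ path e u p, last u p = v & forall w, w \in p -> V w].

Definition gen_graph_connected (k : fieldType) (n : nat)
    (I : {mpoly k[n]} -> Prop) : Prop :=
  connected_graph (min_gens I) (@linear_adj k n).

(* Main.v *)
Require Import Defs.
From mathcomp Require Import all_boot all_order all_algebra.
From mathcomp Require Import mpoly.

(** Complementation turns a facet [F] into the squarefree monomial supported on
    the complement of [F], whose exponent vector is [mesym1 (~: F)]. The claim
    is that this is an isomorphism from the graph of facets, with adjacency in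
    codimension one, onto the graph of minimal generators of the dual ideal;
    an isomorphism preserves connectedness ([connected_graph_image], used in
    both directions).

    - On vertices ([min_gens_dual]): the monomials of the facets generate the
      dual ideal, and none of them divides another because facets are pairwise
      incomparable. A monomial lies in a monomial ideal exactly when one of the
      generators divides it ([mon_idealX]), so a divisibility antichain of
      generators is the only minimal set of monomial generators
      ([min_gens_antichain]).

    - On edges ([linear_adj_codim1]): a relation x_i u = x_j v between the
      monomials u, v of distinct facets [F], [F'] says that both sides are the
      squarefree monomial of the complement of [F :&: F'], that is, that
      [F] and [F'] are obtained from [F :&: F'] by adding i and j
      respectively. As purity gives [#|F| = #|F'|], this amounts to
      [#|F :&: F'| = #|F| - 1]. *)

Set Implicit Arguments.
Unset Strict Implicit.
Unset Printing Implicit Defensive.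

Import GRing.Theory.
Local Open Scope ring_scope.

(** * Connectedness under graph maps *)

(** Preimages of two vertices of [W] are joined by a path in [V], and the image
    of that path joins the vertices themselves. Only edge preservation is
    asked, so that an isomorphism is handled by applying this once to the map
    and once to its inverse. *)
Lemma connected_graph_image (T U : eqType) (V : T -> Prop) (W : U -> Prop)
    (e : rel T) (e' : rel U) (f : T -> U) :
  (forall y, W y <-> exists2 x, V x & y = f x) ->
  (forall x y, V x -> V y -> e x y -> e' (f x) (f y)) ->
  connected_graph V e -> connected_graph W e'.
Proof.
move=> WE fe cV _ _ /WE[x Vx ->] /WE[y Vy ->].
have [p [xp <- pV]] := cV x y Vx Vy.
exists (map f p); rewrite last_map; split=> //.
  elim: p x Vx xp pV {y Vy} => //= z p IHp x Vx /andP[xz zp] pV.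
  have Vz : V z by apply: pV; rewrite inE eqxx.
  rewrite fe //= IHp // => w wp.
  by apply: pV; rewrite inE wp orbT.
by move=> _ /mapP[w wp ->]; apply/WE; exists w; first exact: pV.
Qed.

(** * Minimal generators of monomial ideals *)

Section MonomialIdeals.
Variables (k : fieldType) (n : nat).
Implicit Types (m g : 'X_{1..n}) (G H V : 'X_{1..n} -> Prop).

Lemma mon_idealX G m :
  mon_ideal G 'X_[k, m] <-> exists2 g, G g & (g <= m)%MM.
Proof.
split=> [[s [sG Em]] | [g Gg le_gm]]; last first.
  exists [:: ('X_[m - g], 'X_[g])].
  split; last by rewrite big_seq1 -mpolyXD submK.
  by move=> c; rewrite inE => /eqP->; exists g.
(* The monomial on the left has to occur in one of the summands. *)
have /msupp_sum_le/flattenP[t /mapP[c cs ->]] :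
    m \in msupp (\sum_(c <- s) c.1 * c.2) by rewrite -Em msuppX inE.
rewrite filter_predT in cs.
have [g Gg ->] := sG _ cs.
rewrite (perm_mem (msuppMX _ _)) => /mapP[m' _ ->].
by exists g => //; exact: lem_addr.
Qed.

Lemma eq_mon_ideal_div G H m :
  (forall p : {mpoly k[n]}, mon_ideal G p <-> mon_ideal H p) -> G m ->
  exists2 h, H h & (h <= m)%MM.
Proof.
by move=> GH Gm; apply/mon_idealX/GH/mon_idealX; exists m; rewrite ?lepm_refl.
Qed.

(** If [G] generates the ideal of the antichain [V], each [v] in [V] is
    sandwiched as [v' <= g <= v] for divisibility, with [g] in [G] and [v'] in
    [V], hence [v' = g = v]. So [V] is contained in every monomial generating set. *)
Lemma antichain_sub_gens V G :
  (forall u v, V u -> V v -> (u <= v)%MM -> u = v) ->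
  (forall p : {mpoly k[n]}, mon_ideal G p <-> mon_ideal V p) ->
  forall v, V v -> G v.
Proof.
move=> antiV GV v Vv.
have VG (p : {mpoly k[n]}) : mon_ideal V p <-> mon_ideal G p.
  exact: iff_sym.
have [g Gg le_gv] := eq_mon_ideal_div VG Vv.
have [v' Vv' le_v'g] := eq_mon_ideal_div GV Gg.
have Ev : v' = v by apply: antiV; rewrite ?(lepm_trans le_v'g).
suff -> : v = g by [].
apply/mnmP=> i; apply/eqP; rewrite eqn_leq (mnm_lepP le_gv) -Ev.
by rewrite (mnm_lepP le_v'g).
Qed.

Lemma min_gens_antichain (I : {mpoly k[n]} -> Prop) V :
  (forall u v, V u -> V v -> (u <= v)%MM -> u = v) ->
  (forall p, mon_ideal V p <-> I p) ->
  forall m, min_gens I m <-> V m.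
Proof.
move=> antiV VI m; split=> [[G [GI minG] Gm] | Vm].
  apply: minG Gm => //; apply: antichain_sub_gens antiV _ => p.
  exact: iff_trans (GI p) (iff_sym (VI p)).
exists V => //; split=> // H sHV HI; apply: antichain_sub_gens antiV _ => p.
exact: iff_trans (HI p) (iff_sym (VI p)).
Qed.

End MonomialIdeals.

(** * The monomials of the complements of the facets *)

Section Facets.
Variables (k : fieldType) (n : nat).
Implicit Types (A B F : {set 'I_n}) (D : simplicial_complex n).

Lemma sqfree_monE A : sqfree_mon k A = 'X_[mesym1 A].
Proof.
rewrite mpolyXE_id /sqfree_mon big_mkcond /=; apply: eq_bigr => i _.
by rewrite mnmE; case: (i \in A).
Qed.

Lemma mesym1_le A B : (mesym1 A <= mesym1 B)%MM = (A \subset B).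
Proof.
apply/mnm_lepP/subsetP=> sAB i; have := sAB i; rewrite !mnmE.
  by case: (i \in A); case: (i \in B).
by case: (i \in A) => [->|].
Qed.

Lemma facets_incomparable D F F' :
  F \in facets D -> F' \in facets D -> F \subset F' -> F = F'.
Proof.
rewrite !inE => /maxsetP[_ maxF] /maxsetp DF' sFF'.
by rewrite (maxF F').
Qed.

Lemma min_gens_dual D m :
  min_gens (@stanley_reisner k n (alexander_dual D)) m <->
  exists2 F, F \in facets D & m = mesym1 (~: F).
Proof.
move: m; apply: min_gens_antichain => [_ _ [F DF ->] [F' DF' ->]|p].
  rewrite mesym1_le setCS => sF'F.
  by rewrite (facets_incomparable DF' DF sF'F).
apply: iff_trans (iff_sym (stanley_reisner_dualE D p)).
split; apply: ideal_gen_sub => q.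
  case=> _ [F DF ->] ->; exists 1, 'X_[mesym1 (~: F)]; rewrite mul1r.
  by split=> //; exists F; rewrite ?sqfree_monE.
case=> F DF ->; exists 1, (sqfree_mon k (~: F)); rewrite mul1r; split=> //.
by exists (mesym1 (~: F)); [exists F | rewrite sqfree_monE].
Qed.

(** The two set differences carry the variables: [i] is the unique element of
    [F :\: F'] and [j] the unique element of [F' :\: F]. *)
Lemma linear_adj_codim1 F F' : #|F| = #|F'| ->
  linear_adj k (mesym1 (~: F)) (mesym1 (~: F')) = codim1_adj F F'.
Proof.
move=> eqFF'; apply/andP/eqP => [[neq /existsP[i /existsP[j /eqP]]]|adj].
  rewrite -!mpolyXD => /(congr1 (@msupp n k)).
  rewrite !msuppX => /(congr1 (head 0%MM))/mnmP E.
  have neq_ij : i != j.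
    apply: contraNneq neq => eq_ij; apply/eqP; apply/mnmP=> x.
    by have := E x; rewrite eq_ij !mnmDE => /addnI.
  have Ei := E i; rewrite !mnmE !inE eqxx eq_sym (negPf neq_ij) in Ei.
  have Fi : i \in F by move: Ei; case: (i \in F); case: (i \in F').
  have F'i : i \notin F' by move: Ei; case: (i \in F); case: (i \in F').
  suff -> : F :&: F' = F :\ i by rewrite [RHS](cardsD1 i) Fi.
  apply/setP=> x; rewrite !inE; have [->|neq_xi] /= := eqVneq x i.
    by rewrite (negPf F'i) andbF.
  have := E x; rewrite !mnmE !inE eq_sym (negPf neq_xi) add0n.
  by case: (x \in F); case: (x \in F'); case: (j == x).
have card1 A B : #|A| = #|A :&: B|.+1 -> exists i, A :\: B = [set i].
  move=> cA; apply/cards1P; rewrite -(eqn_add2l #|A :&: B|) cardsID cA.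
  by rewrite addn1.
have [i Ei] := card1 _ _ (esym adj).
have [j Ej] : exists j, F' :\: F = [set j].
  by apply: card1; rewrite setIC adj.
have memi x : (i == x) = (x \notin F') && (x \in F).
  by rewrite eq_sym -in_set1 -Ei inE.
have memj x : (j == x) = (x \notin F) && (x \in F').
  by rewrite eq_sym -in_set1 -Ej inE.
split.
  apply/eqP=> /inj_mesym1/(inv_inj (@setCK _)) eqF.
  by have := memi i; rewrite eqxx eqF andNb.
apply/existsP; exists i; apply/existsP; exists j; rewrite -!mpolyXD.
apply/eqP; congr 'X_[_]; apply/mnmP=> x; rewrite !mnmE !inE memi memj.
by case: (x \in F); case: (x \in F').
Qed.

End Facets.

Theorem lemma4p1 (k : fieldType) (n : nat) (D : simplicial_complex n)
    (pureD : pure D) :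
  connected_in_codim1 D <->
  gen_graph_connected (@stanley_reisner k n (alexander_dual D)).
Proof.
have adjE F F' : F \in facets D -> F' \in facets D ->
    linear_adj k (mesym1 (~: F)) (mesym1 (~: F')) = codim1_adj F F'.
  by move=> DF DF'; apply/linear_adj_codim1/pureD.
split.
  apply: (connected_graph_image (f := fun F => mesym1 (~: F))).
    exact: min_gens_dual.
  by move=> F F' DF DF'; rewrite adjE.
(* The inverse map recovers a facet as the complement of the support. *)
pose supp_compl (m : 'X_{1..n}) : {set 'I_n} := [set i | m i == 0%N].
have supp_complK F : supp_compl (mesym1 (~: F)) = F.
  by apply/setP=> i; rewrite !inE mnmE inE eqb0 negbK.
apply: (connected_graph_image (f := supp_compl)) => [F|m m'].
  split=> [DF|[m /min_gens_dual[F' DF' ->] ->]]; last by rewrite supp_complK.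
  exists (mesym1 (~: F)); last by rewrite supp_complK.
  by apply/min_gens_dual; exists F.
move=> /min_gens_dual[F DF ->] /min_gens_dual[F' DF' ->].
by rewrite !supp_complK adjE.
Qed.
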